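(* In any triangle $ABC$ with side lengths $a, b, c$, area $S$, circumradius $R$ and inradius $r$, the following inequality holds: $$a^{2}+b^{2}+c^{2}\geq 4S\sqrt{3+\frac{4(R-2r)}{4R+r}}+(a-b)^{2}+(b-c)^{2}+(c-a)^{2}.$$
   Context: Triangles are nondegenerate Euclidean triangles. *)

(* Defs.v *)
From mathcomp Require Import all_boot all_order all_algebra.
From mathcomp Require Import reals.

Set Implicit Arguments.
Unset Strict Implicit.
Unset Printing Implicit Defensive.

Import Order.TTheory GRing.Theory Num.Theory.
Local Open Scope ring_scope.

Section EuclideanPlane.
Variable R : realType.
Implicit Types (A B C I P Q T u v : 'rV[R]_2) (r : R).

Definition dotv u v : R := (u *m v^T) 0 0.

(* MathComp-Analysis equips 'rV[R]_2 with the max norm, hence this definition. *)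
Definition edist P Q : R := Num.sqrt (dotv (Q - P) (Q - P)).

Definition edge_matrix A B C : 'M[R]_2 := col_mx (B - A) (C - A).

(* Nondegeneracy: the vertices are not collinear, i.e. the edge vectors issued
   from A are linearly independent. *)
Definition triangle A B C : bool := row_free (edge_matrix A B C).

Definition area A B C : R := `|\det (edge_matrix A B C)| / 2%:R.

Definition is_circumradius A B C r : Prop :=
  exists O : 'rV[R]_2, [/\ edist O A = r, edist O B = r & edist O C = r].

Definition on_segment P Q T : Prop :=
  exists2 t : R, 0 <= t <= 1 & T = P + t *: (Q - P).

(* The circle of center I and radius r touches the side [P, Q] at a point T of
   that side: T is on the circle and the radius IT is perpendicular to PQ. *)
Definition tangent_to_side I r P Q : Prop :=
  exists T, [/\ on_segment P Q T, edist I T = r & dotv (T - I) (Q - P) = 0].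

(* The points of contact are required to lie on the sides themselves, not just
   on the lines extending them; this excludes the three excircles. *)
Definition is_inradius A B C r : Prop :=
  0 < r /\
  exists I, [/\ tangent_to_side I r A B, tangent_to_side I r B C
              & tangent_to_side I r C A].

End EuclideanPlane.

(* Main.v *)
Require Import Defs.
From mathcomp Require Import all_boot all_order all_algebra.
From mathcomp Require Import reals.
From mathcomp Require Import ring lra.

Set Implicit Arguments.
Unset Strict Implicit.
Unset Printing Implicit Defensive.

Import Order.TTheory GRing.Theory Num.Theory.
Local Open Scope ring_scope.

(** Let x, y, z be the tangent lengths from A, B, C to the incircle and
    s = x + y + z, p = xy + yz + zx. Then r^2 s = xyz, S = r s and
    p = r (4R + r), so the left-hand side minus the three squares is 4p, and
    the claim becomes p^3 - 4 s p (xyz) + 9 (xyz)^2 >= 0. This is Schur's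
    inequality for the three numbers xy, yz, zx. *)

(** The expression is x(x-y)(x-z) + y(y-z)(y-x) + z(z-x)(z-y) in elementary symmetric functions; by
    symmetry, sorted arguments suffice. *)
Lemma schur_deg1 (F : realFieldType) (x y z : F) :
  0 <= x -> 0 <= y -> 0 <= z ->
  0 <= (x + y + z) ^+ 3 - 4%:R * (x + y + z) * (x * y + y * z + z * x)
       + 9%:R * (x * y * z).
Proof.
have sorted (u v w : F) : 0 <= w -> w <= v -> v <= u ->
    0 <= (u + v + w) ^+ 3 - 4%:R * (u + v + w) * (u * v + v * w + w * u)
         + 9%:R * (u * v * w).
  move=> w0 wv vu.
  (* The terms of the Schur sum led by u and v share the factor u - v; grouping them leaves only
     nonnegative products. *)
  have -> : (u + v + w) ^+ 3 - 4%:R * (u + v + w) * (u * v + v * w + w * u)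
      + 9%:R * (u * v * w)
      = (u - v) ^+ 2 * (u + (v - w)) + w * ((u - w) * (v - w)) by ring.
  have wu := le_trans wv vu.
  rewrite addr_ge0 // mulr_ge0 ?sqr_ge0 ?mulr_ge0 ?subr_ge0 //.
  by rewrite addr_ge0 ?subr_ge0 // (le_trans w0).
move=> x0 y0 z0.
have [xy|/ltW yx] := leP x y; have [yz|/ltW zy] := leP y z;
  have [xz|/ltW zx] := leP x z.
- by have := sorted z y x x0 xy yz; congr (0 <= _); ring.
- by have := sorted z y x x0 xy yz; congr (0 <= _); ring.
- by have := sorted y z x x0 xz zy; congr (0 <= _); ring.
- by have := sorted y x z z0 zx xy; congr (0 <= _); ring.
- by have := sorted z x y y0 yx xz; congr (0 <= _); ring.
- by have := sorted x z y y0 yz zx; congr (0 <= _); ring.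
- by have := sorted x y z z0 zy yx; congr (0 <= _); ring.
- by have := sorted x y z z0 zy yx; congr (0 <= _); ring.
Qed.

(** * Metric relations in the plane: tangents, bisectors, circumradius *)

Section PlaneGeometry.
Variable K : realType.
Implicit Types (A B C I P Q u v w : 'rV[K]_2) (r x y z b c : K).

Definition crossv u v : K := u 0 0 * v 0 1 - u 0 1 * v 0 0.

Lemma dotvE u v : dotv u v = u 0 0 * v 0 0 + u 0 1 * v 0 1.
Proof.
rewrite /dotv mxE big_ord_recl big_ord1 !mxE.
by congr (_ * _ + u _ _ * v _ _); apply/val_inj.
Qed.

Lemma dotv_ge0 u : 0 <= dotv u u.
Proof. by rewrite dotvE -!expr2 addr_ge0 ?sqr_ge0. Qed.

Lemma edist_ge0 P Q : 0 <= edist P Q.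
Proof. exact: sqrtr_ge0. Qed.

Lemma sqr_edist P Q : edist P Q ^+ 2 = dotv (Q - P) (Q - P).
Proof. exact: sqr_sqrtr (dotv_ge0 _). Qed.

Lemma edistC P Q : edist P Q = edist Q P.
Proof. by congr Num.sqrt; rewrite !dotvE !mxE; ring. Qed.

Lemma det_edge_matrix A B C : \det (edge_matrix A B C) = crossv (B - A) (C - A).
Proof.
rewrite (expand_det_row _ 0) big_ord_recl big_ord1 /cofactor !det_mx11 !mxE.
case: splitP => [i _|//]; case: splitP => [[[]] //|j _].
rewrite (ord1 i) (ord1 j) /crossv.
have -> : lift (lift ord0 ord0) 0 = 0 :> 'I_2 by apply/val_inj.
have -> : lift ord0 0 = 1 :> 'I_2 by apply/val_inj.
rewrite /= expr0 expr1; ring.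
Qed.

Lemma crossv_triangle A B C : triangle A B C -> crossv (B - A) (C - A) != 0.
Proof.
by rewrite /triangle row_free_unit unitmxE unitfE det_edge_matrix.
Qed.

Lemma crossv_rot A B C : crossv (C - B) (A - B) = crossv (B - A) (C - A).
Proof. by rewrite /crossv !mxE; ring. Qed.

(** The contact point T splits the side into x = PT and y = TQ. As IT is perpendicular to PQ, T is
    the projection of I, and Pythagoras gives IP and IQ. *)
Lemma tangent_lengths I r P Q : tangent_to_side I r P Q ->
  exists x y : K, [/\ 0 <= x, 0 <= y, x + y = edist P Q,
    dotv (I - P) (Q - P) = x * edist P Q /\
      dotv (I - P) (I - P) = x ^+ 2 + r ^+ 2
  & dotv (I - Q) (P - Q) = y * edist P Q /\
      dotv (I - Q) (I - Q) = y ^+ 2 + r ^+ 2].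
Proof.
case=> T [[t /andP[t0 t1] TE] <- perp].
have wu : dotv (I - P) (Q - P) = t * edist P Q ^+ 2.
  by move: perp; rewrite sqr_edist TE !dotvE !mxE => perp; lra.
have ITr : edist I T ^+ 2 = dotv (I - P) (I - P)
    - 2%:R * t * dotv (I - P) (Q - P) + t ^+ 2 * edist P Q ^+ 2.
  by rewrite !sqr_edist TE !dotvE !mxE; ring.
have QE : dotv (I - Q) (P - Q) = edist P Q ^+ 2 - dotv (I - P) (Q - P).
  by rewrite sqr_edist !dotvE !mxE; ring.
have QQ : dotv (I - Q) (I - Q) = dotv (I - P) (I - P)
    - 2%:R * dotv (I - P) (Q - P) + edist P Q ^+ 2.
  by rewrite sqr_edist !dotvE !mxE; ring.
exists (t * edist P Q), ((1 - t) * edist P Q).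
split; rewrite ?mulr_ge0 ?subr_ge0 ?edist_ge0 //; first by ring.
- by rewrite ITr wu; split; ring.
- by rewrite QE QQ ITr wu; split; ring.
Qed.

(* If w makes the same angle with the independent vectors u and v, it spans
   their bisector; this is the double angle formula
   cos(2 theta) = (x^2 - r^2) / (x^2 + r^2) where tan theta = r / x. *)
Lemma bisector_cos u v w b c x r :
  0 < b -> 0 < c -> 0 < r -> crossv u v != 0 ->
  dotv u u = c ^+ 2 -> dotv v v = b ^+ 2 ->
  dotv w u = x * c -> dotv w v = x * b -> dotv w w = x ^+ 2 + r ^+ 2 ->
  dotv u v * (x ^+ 2 + r ^+ 2) = b * c * (x ^+ 2 - r ^+ 2).
Proof.
move=> b0 c0 r0 D0 uu vv wu wv ww.
have lagrange (p q : 'rV[K]_2) :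
    crossv p q ^+ 2 = dotv p p * dotv q q - dotv q p ^+ 2.
  by rewrite /crossv !dotvE; ring.
have du : crossv u w ^+ 2 = (c * r) ^+ 2.
  by rewrite lagrange uu ww wu; ring.
have dv : crossv v w ^+ 2 = (b * r) ^+ 2.
  by rewrite lagrange vv ww wv; ring.
have split_dot : dotv u v * dotv w w
    = dotv w u * dotv w v + crossv u w * crossv v w.
  by rewrite /crossv !dotvE; ring.
have : (b * crossv u w) ^+ 2 == (c * crossv v w) ^+ 2.
  by rewrite !exprMn du dv; apply/eqP; ring.
(* With equal signs, u/c and v/b have the same dot and cross products with the nonzero w, hence
   coincide, against independence. Opposite signs mean that w runs between u and v. *)
rewrite eqf_sqr => /orP[/eqP same|/eqP opp].
  have W0 : dotv w w != 0 by rewrite ww; apply/lt0r_neq0; nra.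
  case/negP: D0; rewrite -(inj_eq (mulfI (lt0r_neq0 b0))) mulr0.
  rewrite -(inj_eq (mulfI W0)) mulr0.
  have -> : dotv w w * (b * crossv u v) =
      dotv w v * (b * crossv u w) - b * dotv w u * crossv v w.
    by rewrite /crossv !dotvE; ring.
  by rewrite same wu wv; apply/eqP; ring.
have prod : crossv u w * crossv v w = - (b * c * r ^+ 2).
  apply: (mulfI (lt0r_neq0 b0)).
  transitivity (- (c * crossv v w ^+ 2)); first by rewrite mulrA opp; ring.
  by rewrite dv; ring.
by rewrite -ww split_dot prod wu wv; ring.
Qed.

(** This is abc = 4RS, as the cross product is twice the signed area. The vector from A to the
    circumcenter is determined by its products with the edges, each half a squared edge length. *)
Lemma circumradius_cross A B C R : is_circumradius A B C R ->
  0 <= R /\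
  edist B C * edist C A * edist A B = 2%:R * R * `|crossv (B - A) (C - A)|.
Proof.
case=> O [RA RB RC]; have R0 : 0 <= R by rewrite -RA edist_ge0.
split=> //; apply/eqP; rewrite -(@eqrXn2 _ 2) ?mulr_ge0 ?edist_ge0 //.
rewrite !exprMn real_normK ?num_real // !sqr_edist.
have := sqr_edist O A; have := sqr_edist O B; have := sqr_edist O C.
rewrite RA RB RC => eC eB eA.
have ou : 2%:R * dotv (O - A) (B - A) = dotv (B - A) (B - A).
  by move: eA eB; rewrite !dotvE !mxE; nra.
have ov : 2%:R * dotv (O - A) (C - A) = dotv (C - A) (C - A).
  by move: eA eC; rewrite !dotvE !mxE; nra.
rewrite eA.
set u := B - A in ou *; set v := C - A in ov *; set o := O - A in ou ov.
have -> : dotv (C - B) (C - B) = dotv u u + dotv v v - 2%:R * dotv u v.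
  by rewrite /u /v !dotvE !mxE; ring.
have -> : dotv (A - C) (A - C) = dotv v v by rewrite /v !dotvE !mxE; ring.
have -> : dotv (A - O) (A - O) = dotv o o by rewrite /o !dotvE !mxE; ring.
(* The middle term comes from the vanishing Gram determinant of the three plane vectors o, u, v. *)
apply/eqP; transitivity (4%:R * (dotv o u ^+ 2 * dotv v v
  + dotv o v ^+ 2 * dotv u u - 2%:R * dotv o u * dotv o v * dotv u v)).
  by rewrite -ou -ov; ring.
by rewrite /crossv !dotvE; ring.
Qed.

Lemma cosine_rule A B C : 2%:R * dotv (B - A) (C - A) =
  edist A B ^+ 2 + edist C A ^+ 2 - edist B C ^+ 2.
Proof. by rewrite !sqr_edist !dotvE !mxE; ring. Qed.

Lemma edist_gt0 A B C : triangle A B C ->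
  [/\ 0 < edist B C, 0 < edist C A & 0 < edist A B].
Proof.
move=> /crossv_triangle D0.
have pos P Q R : crossv (Q - P) (R - P) != 0 -> 0 < edist P Q.
  move=> h; rewrite lt_neqAle edist_ge0 andbT; apply: contra h => /eqP e0.
  have := sqr_edist P Q; rewrite -e0 expr0n /= dotvE -!expr2 => /esym/eqP.
  by rewrite paddr_eq0 ?sqr_ge0 // !sqrf_eq0 /crossv => /andP[/eqP-> /eqP->];
    rewrite !mul0r subr0 eqxx.
split; first by apply: (pos _ _ A); rewrite crossv_rot.
  by apply: (pos _ _ B); rewrite 2!crossv_rot.
exact: (pos _ _ C).
Qed.

(* The factor x is kept so that the case x = 0 needs no separate treatment. *)
Lemma tangent_length_eq A B C I r x y z :
  triangle A B C -> 0 < r ->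
  edist A B = x + y -> edist B C = y + z -> edist C A = z + x ->
  dotv (I - A) (B - A) = x * edist A B ->
  dotv (I - A) (C - A) = x * edist C A ->
  dotv (I - A) (I - A) = x ^+ 2 + r ^+ 2 ->
  x * (r ^+ 2 * (x + y + z)) = x * (x * y * z).
Proof.
move=> tri r0 cE aE bE wu wv ww.
have [_ b0 c0] := edist_gt0 tri.
have := bisector_cos b0 c0 r0 (crossv_triangle tri) (esym (sqr_edist _ _))
  _ wu wv ww.
rewrite [edist C A]edistC sqr_edist => /(_ erefl).
have := cosine_rule A B C; rewrite [edist A C]edistC aE bE cE => cosA bis.
have {}cosA : dotv (B - A) (C - A) = x ^+ 2 + x * y + x * z - y * z by lra.
(* Here [cosA] equals bc - 2yz with bc = (x + y)(z + x), so [bis] reduces to bc r^2 = yz (x^2 +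
   r^2). *)
by move: bis; rewrite cosA; nra.
Qed.

End PlaneGeometry.

(** * The incircle in terms of three tangent lengths *)

Lemma triangle_rot (K : realType) (A B C : 'rV[K]_2) :
  triangle A B C -> triangle B C A.
Proof.
by rewrite /triangle !row_free_unit !unitmxE !det_edge_matrix (crossv_rot A).
Qed.

Lemma inradius_tangent_lengths (K : realType) (A B C : 'rV[K]_2) (r : K) :
  triangle A B C -> is_inradius A B C r ->
  exists x y z : K, [/\ [/\ 0 < x, 0 < y & 0 < z],
    [/\ edist A B = x + y, edist B C = y + z & edist C A = z + x]
  & r ^+ 2 * (x + y + z) = x * y * z].
Proof.
move=> tri [r0 [I [/tangent_lengths[x [y [x0 y0 cE [ux xx] [uy yy]]]]
  /tangent_lengths[y' [z [y'0 z0 aE [vy yy'] [vz zz]]]]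
  /tangent_lengths[z' [x' [z'0 x'0 bE [wz zz'] [wx xx']]]]]]].
(* Both tangent lengths at a vertex P have square IP^2 - r^2, so the six lengths reduce to three. *)
have uniq (t t' : K) (P : 'rV[K]_2) : 0 <= t -> 0 <= t' ->
    dotv (I - P) (I - P) = t ^+ 2 + r ^+ 2 ->
    dotv (I - P) (I - P) = t' ^+ 2 + r ^+ 2 -> t' = t.
  move=> t0 t'0 -> /addIr/eqP; rewrite eqrXn2 // => /eqP -> //.
have e1 := uniq _ _ _ x0 x'0 xx xx'; have e2 := uniq _ _ _ y0 y'0 yy yy'.
have e3 := uniq _ _ _ z0 z'0 zz zz'; subst x' y' z'.
have [a0 b0 c0] := edist_gt0 tri.
have rel : r ^+ 2 * (x + y + z) = x * y * z.
  have relx := tangent_length_eq tri r0 (esym cE) (esym aE) (esym bE) ux wx xx.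
  have rely := tangent_length_eq (triangle_rot tri) r0 (esym aE) (esym bE)
    (esym cE) vy uy yy.
  (* Neither x nor y is known to be nonzero yet, but the relations at A and B add up to one with the
     factor x + y = AB > 0. *)
  apply: (mulfI (lt0r_neq0 c0)); rewrite -cE; lra.
have xyz0 : x * y * z != 0.
  by rewrite -rel mulf_neq0 ?lt0r_neq0 ?exprn_gt0 //; lra.
move: xyz0; rewrite !mulf_eq0 !negb_or -andbA => /and3P[xn yn zn].
by exists x, y, z; rewrite !lt0r xn yn zn.
Qed.

Theorem theorem2p2 (K : realType) (A B C : 'rV[K]_2) (a b c S R r : K)
    (hABC : triangle A B C)
    (ha : a = edist B C) (hb : b = edist C A) (hc : c = edist A B)
    (hS : S = area A B C)
    (hR : is_circumradius A B C R)
    (hr : is_inradius A B C r) :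
  a ^+ 2 + b ^+ 2 + c ^+ 2 >=
    4%:R * S * Num.sqrt (3%:R + 4%:R * (R - 2%:R * r) / (4%:R * R + r))
    + (a - b) ^+ 2 + (b - c) ^+ 2 + (c - a) ^+ 2.
Proof.
have r0 : 0 < r by case: hr.
have [x [y [z [[x0 y0 z0] [cE aE bE] rel]]]] := inradius_tangent_lengths hABC hr.
have [R0] := circumradius_cross hR.
move: hS; rewrite /area det_edge_matrix.
set D := crossv _ _ => hS circ.
set s := x + y + z in rel.
have s0 : 0 < s by rewrite /s; lra.
(* Heron's formula: D^2 = 4 s xyz, which is 4 (rs)^2 by [rel]. *)
have D_E : `|D| = 2%:R * (r * s).
  apply/eqP; rewrite -(@eqrXn2 _ 2) ?mulr_ge0 ?(ltW r0) ?(ltW s0) ?normr_ge0 //.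
  rewrite real_normK ?num_real //.
  have : D ^+ 2 = edist A B ^+ 2 * edist C A ^+ 2 - dotv (B - A) (C - A) ^+ 2.
    by rewrite !sqr_edist /D /crossv !dotvE !mxE; ring.
  have := cosine_rule A B C; rewrite aE bE cE => cosA.
  have -> : dotv (B - A) (C - A) = x ^+ 2 + x * y + x * z - y * z by lra.
  move=> ->; apply/eqP; rewrite !exprMn.
  have -> : r ^+ 2 * s ^+ 2 = s * (x * y * z) by rewrite -rel; ring.
  by rewrite /s; ring.
have SE : S = r * s by rewrite hS D_E; field.
set m := 4%:R * R + r.
have m0 : 0 < m by rewrite /m; lra.
(* From abc = 4Rrs and (x + y)(y + z)(z + x) = s (xy + yz + zx) - xyz, where xyz = r^2 s. *)
have pE : r * m = x * y + y * z + z * x.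
  apply: (mulfI (lt0r_neq0 s0)).
  move: circ rel; rewrite D_E aE bE cE /m /s => circ rel; nra.
(* The bound m / s is chosen because S = rs turns it into rm = xy + yz + zx. *)
have sqrt_le : Num.sqrt (3%:R + 4%:R * (R - 2%:R * r) / m) <= m / s.
  rewrite -[m / s]gtr0_norm ?divr_gt0 // -sqrtr_sqr; apply: ler_wsqrtr.
  have -> : 3%:R + 4%:R * (R - 2%:R * r) / m = (4%:R * m - 9%:R * r) / m.
    by rewrite /m; field; apply: lt0r_neq0.
  rewrite expr_div_n ler_pdivrMr // mulrAC ler_pdivlMr ?exprn_gt0 //.
  (* The factor r^3 makes every term a polynomial in rm, s and r^2 s = xyz, which is the Schur
     expression. *)
  rewrite -subr_ge0 -(pmulr_rge0 _ (exprn_gt0 3 r0)).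
  have -> : r ^+ 3 * (m ^+ 2 * m - (4%:R * m - 9%:R * r) * s ^+ 2)
      = (r * m) ^+ 3 - 4%:R * (r * m) * (s * (r ^+ 2 * s))
        + 9%:R * (r ^+ 2 * s) ^+ 2 by ring.
  rewrite rel pE.
  have := schur_deg1 (ltW (mulr_gt0 x0 y0)) (ltW (mulr_gt0 y0 z0))
    (ltW (mulr_gt0 z0 x0)).
  by congr (0 <= _); rewrite /s; ring.
have : S * Num.sqrt (3%:R + 4%:R * (R - 2%:R * r) / m) <= r * m.
  apply: le_trans (ler_wpM2l _ sqrt_le) _; first by rewrite SE ltW ?mulr_gt0.
  by rewrite SE le_eqVlt; apply/orP; left; apply/eqP; field; apply: lt0r_neq0.
rewrite pE ha hb hc aE bE cE -[4%:R * S * _]mulrA; lra.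
Qed.
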